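(* (i) If $1\le p,q<\infty$ and $p\neq q$, then $\ell_p$ does not Lipschitz embed into $\ell_q$. (ii) If $0<p<1<q<\infty$, then $\ell_q$ does not Lipschitz embed into $(\ell_p,d_p)$, and $(\ell_p,d_p)$ does not Lipschitz embed into $\ell_q$. (iii) If $0<p<q\le 1$, then $(\ell_p,d_p)$ Lipschitz embeds into $(\ell_q,d_q)$, but $(\ell_q,d_q)$ does not Lipschitz embed into $(\ell_p,d_p)$.
   Context: All sequence spaces are real. For $0<p\le 1$, $d_p(x,y)=\sum_{n}|x_n-y_n|^p$ on $\ell_p$; for $p\ge 1$, $\ell_p$ carries its usual norm metric. A metric space $(\mathcal M_1,d_1)$ Lipschitz embeds into $(\mathcal M_2,d_2)$ if there are a one-to-one map $f:\mathcal M_1\to\mathcal M_2$ and constants $A,B>0$ with $A^{-1}d_1(x,y)\le d_2(f(x),f(y))\le B\,d_1(x,y)$ for all $x,y\in\mathcal M_1$. *)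

(* Defs.v *)
From HB Require Import structures.
From mathcomp Require Import all_boot all_order all_algebra.
From mathcomp Require Import all_classical all_reals all_analysis.

Set Implicit Arguments.
Unset Strict Implicit.
Unset Printing Implicit Defensive.
Import Order.TTheory GRing.Theory Num.Theory.
Import numFieldNormedType.Exports.
Local Open Scope classical_set_scope.
Local Open Scope ring_scope.

Definition lipschitz_embeds (R : realType) (M1 M2 : metricType R) : Prop :=
  exists f : M1 -> M2, injective f /\
    exists A B : R, [/\ 0 < A, 0 < B & forall x y : M1,
      A^-1 * mdist x y <= mdist (f x) (f y) <= B * mdist x y].

Record ell (R : realType) (p : R) := Ell {
  ell_seq :> nat -> R ;
  ell_summable : cvgn (series (fun n => `|ell_seq n| `^ p)) }.

Section ell_distances.
Variables (R : realType) (p : R).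
Implicit Types x y z : ell p.

Definition ell_psum x y : R := limn (series (fun n => `|x n - y n| `^ p)).

Definition ell_norm_dist x y : R := ell_psum x y `^ p^-1.

HB.instance Definition _ := gen_eqMixin (ell p).
HB.instance Definition _ := gen_choiceMixin (ell p).

Lemma ellP x y : (forall n, x n = y n) -> x = y.
Proof.
case: x y => [x xs] [y ys] /= /funext xy.
by subst y; congr Ell; exact: Prop_irrelevance.
Qed.

Hypothesis p0 : 0 < p.

Lemma powRD_le (a b : R) : 0 <= a -> 0 <= b ->
  (a + b) `^ p <= 2 `^ p * (a `^ p + b `^ p).
Proof.
move=> a0 b0.
wlog ab : a b a0 b0 / a <= b.
  move=> h; have [ab|/ltW ba] := leP a b; first exact: h.
  by rewrite addrC (addrC (a `^ p)); exact: h.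
rewrite (@le_trans _ _ ((2 * b) `^ p))//.
  rewrite ge0_ler_powR ?nnegrE ?addr_ge0 ?mulr_ge0//; first exact: ltW.
  by rewrite mulr_natl mulr2n lerD2r.
by rewrite powRM// ler_wpM2l ?powR_ge0// lerDr powR_ge0.
Qed.

Lemma ell_cvg x y : cvgn (series (fun n => `|x n - y n| `^ p)).
Proof.
apply: (@series_le_cvg _ _
  (fun n => 2 `^ p * (`|x n| `^ p + `|y n| `^ p))) => [n|n|n|].
- exact: powR_ge0.
- by rewrite mulr_ge0 ?addr_ge0 ?powR_ge0.
- apply: le_trans (powRD_le _ _) => //.
  by rewrite ge0_ler_powR ?nnegrE ?addr_ge0 ?ler_normB//; exact: ltW.
- apply: is_cvg_seriesZ; apply: is_cvg_seriesD; exact: ell_summable.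
Qed.

Lemma ell_psum_ge x y n : `|x n - y n| `^ p <= ell_psum x y.
Proof.
rewrite (@le_trans _ _ (series (fun n => `|x n - y n| `^ p) n.+1))//.
  by rewrite seriesEnat /= big_nat_recr//= lerDr sumr_ge0.
apply: nondecreasing_cvgn_le; last exact: ell_cvg.
apply/nondecreasing_seqP => k.
by rewrite !seriesEnat /= big_nat_recr//= lerDl powR_ge0.
Qed.

Lemma ell_psum_ge0 x y : 0 <= ell_psum x y.
Proof. exact: le_trans (powR_ge0 _ _) (ell_psum_ge x y 0). Qed.

Lemma ell_psumxx x : ell_psum x x = 0.
Proof.
rewrite /ell_psum (_ : series _ = cst 0) ?lim_cst//.
apply/funext => n; rewrite seriesEnat /= big1// => i _.
by rewrite subrr normr0 powR0// gt_eqF.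
Qed.

Lemma ell_psum_eq0 x y : ell_psum x y = 0 -> x = y.
Proof.
move=> xy; apply: ellP => n; apply/eqP; rewrite -subr_eq0 -normr_eq0.
apply/eqP/(@powR_eq0_eq0 _ _ p)/eqP.
by rewrite eq_le powR_ge0 andbT -xy ell_psum_ge.
Qed.

Lemma ell_psumC x y : ell_psum x y = ell_psum y x.
Proof.
by rewrite /ell_psum; congr (limn (series _)); apply/funext => n; rewrite distrC.
Qed.

Lemma powR_subadd (a b : R) : p <= 1 -> 0 <= a -> 0 <= b ->
  (a + b) `^ p <= a `^ p + b `^ p.
Proof.
move=> p1; rewrite le_eqVlt => /predU1P[<-|a0].
  by rewrite add0r lerDr powR_ge0.
rewrite le_eqVlt => /predU1P[<-|b0]; first by rewrite addr0 lerDl powR_ge0.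
have s0 : 0 < a + b by rewrite addr_gt0.
have frac c : 0 < c -> c <= a + b -> c / (a + b) * (a + b) `^ p <= c `^ p.
  move=> c0 cs; rewrite -[in leRHS](divfK (lt0r_neq0 s0) c).
  rewrite powRM; [|by rewrite divr_ge0// ltW|exact: ltW].
  rewrite ler_wpM2r ?powR_ge0// ger1_powR//.
  by rewrite divr_gt0// ler_pdivrMr// mul1r.
rewrite -[leLHS]mul1r -(divff (lt0r_neq0 s0)) mulrDl mulrDl.
by rewrite lerD// frac// ?lerDl ?lerDr; exact: ltW.
Qed.

Lemma ell_psum_triangle (p1 : p <= 1) y x z :
  ell_psum x z <= ell_psum x y + ell_psum y z.
Proof.
rewrite /ell_psum -lim_seriesD; [|exact: ell_cvg..].
apply: lim_series_le => [||n]; first exact: ell_cvg.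
  apply: is_cvg_seriesD; exact: ell_cvg.
apply: le_trans (powR_subadd _ _ _) => //.
rewrite ge0_ler_powR ?nnegrE ?addr_ge0//; first exact: ltW.
by rewrite (le_trans _ (ler_normD _ _))// addrA subrK.
Qed.

Lemma ell_Lnorm x y :
  Lnorm (@counting nat R) p%:E (EFin \o (fun n => x n - y n)) =
    (ell_norm_dist x y)%:E.
Proof.
rewrite Lnorm_counting// /ell_norm_dist -poweR_EFin; congr poweR.
rewrite /ell_psum -EFin_lim; last exact: ell_cvg.
congr (limn _); apply/funext => n /=; rewrite seriesEnat /= sumEFin.
by congr EFin; apply: eq_bigr => i _.
Qed.

Lemma ell_norm_dist_triangle (p1 : 1 <= p) y x z :
  ell_norm_dist x z <= ell_norm_dist x y + ell_norm_dist y z.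
Proof.
have := @minkowski_EFin _ _ _ (@counting nat R) (fun n => x n - y n)
  (fun n => y n - z n) p.
rewrite (_ : (fun n => x n - y n) \+ (fun n => y n - z n) =
  (fun n => x n - z n)); last by apply/funext => n /=; rewrite addrA subrK.
by rewrite !ell_Lnorm -EFinD lee_fin; apply.
Qed.

End ell_distances.

(* [ell_dp] and [ell_norm] are aliases of [ell p] indexed by the range of p:
   the first carries the metric d_p, the second the metric of the l_p-norm. *)
Definition ell_dp (R : realType) (p : R) (p01 : 0 < p <= 1) := ell p.

Section ell_dp_metric.
Variables (R : realType) (p : R) (p01 : 0 < p <= 1).
Let p0 : 0 < p. Proof. by case/andP: p01. Qed.
Let p1 : p <= 1. Proof. by case/andP: p01. Qed.

HB.instance Definition _ := Choice.on (ell_dp p01).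
HB.instance Definition _ := @isMetric.Build R (ell_dp p01) (@ell_psum R p)
  (ell_psumxx p0) (ell_psum_eq0 p0) (@ell_psumC R p) (ell_psum_triangle p0 p1).

Lemma mdist_ell_dpE (x y : ell_dp p01) :
  mdist x y = limn (series (fun n => `|x n - y n| `^ p)).
Proof. by []. Qed.

End ell_dp_metric.

Definition ell_norm (R : realType) (p : R) (p1 : 1 <= p) := ell p.

Section ell_norm_metric.
Variables (R : realType) (p : R) (p1 : 1 <= p).
Let p0 : 0 < p. Proof. exact: lt_le_trans p1. Qed.

Let ell_norm_distxx x : @ell_norm_dist R p x x = 0.
Proof. by rewrite /ell_norm_dist ell_psumxx// powR0// invr_eq0 gt_eqF. Qed.

Let ell_norm_dist_eq0 x y : @ell_norm_dist R p x y = 0 -> x = y.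
Proof. by move/powR_eq0_eq0/ell_psum_eq0; exact. Qed.

Let ell_norm_distC x y : @ell_norm_dist R p x y = ell_norm_dist y x.
Proof. by rewrite /ell_norm_dist ell_psumC. Qed.

HB.instance Definition _ := Choice.on (ell_norm p1).
HB.instance Definition _ := @isMetric.Build R (ell_norm p1)
  (@ell_norm_dist R p) ell_norm_distxx ell_norm_dist_eq0 ell_norm_distC
  (ell_norm_dist_triangle p0 p1).

Lemma mdist_ell_normE (x y : ell_norm p1) :
  mdist x y = limn (series (fun n => `|x n - y n| `^ p)) `^ p^-1.
Proof. by []. Qed.

End ell_norm_metric.

(* Main.v *)
Require Import Defs.
From HB Require Import structures.
From mathcomp Require Import all_boot all_order all_algebra.
From mathcomp Require Import all_classical all_reals all_analysis.
From mathcomp Require Import ring lra.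

Set Implicit Arguments.
Unset Strict Implicit.
Unset Printing Implicit Defensive.
Import Order.TTheory GRing.Theory Num.Theory.
Import numFieldNormedType.Exports.
Local Open Scope classical_set_scope.
Local Open Scope ring_scope.

(** Every distance of the statement is a power sum [sum_n |x_n - y_n|^q], or
the q-th root of one. Four independent phenomena decide all the cases.

Concentration, for exponents [a < q] with [1 < q]. Let [F] be Lipschitz with
values in [ell_q], and let [e_n] be the unit vectors. Replacing [F] by the
coordinatewise limit [TF(x) = lim_n F(x - e_n)] along an ultrafilter gives a
map with the same Lipschitz behaviour, and [F(x - e_n) - TF(x)] is bounded and
tends to 0 in each coordinate, hence is asymptotically disjoint from any fixed
vector. So passing from [TF(x)] to [F(x - e_n)], for some large [n], adds only
a constant to the power sum of the distance to a fixed [w]. Iterating, any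
tail of the integers contains a set of size [k] for which the image of
[- sum_(n in s) e_n] is at distance at most [C k^(1/q)] from one and the same
point [T^k F(0)] ([concentration]). Two disjoint such sets are at least
[k^(1/a)] apart in the source, where [a = p] for the norm of [ell_p] and [a = 1] for [d_p];
this is impossible for large [k] as [a < q] ([spread_not_embeds]).

Approximate midpoints, for norms with [q < p]. Choose [x], [y] which nearly
realise the best Lipschitz constant of [f]; approximate midpoints of [x], [y]
are then mapped to approximate midpoints of [f x], [f y]. With relative error
[eta], the points [(x + y)/2 - r e_n] with [r] of order [eta^(1/p)] are
approximate midpoints in [ell_p] ([spread_midpoints]), whereas in [ell_q] the
approximate midpoints lie within order [eta^(1/q)] of a compact set
([midpoints_cluster]). Hence [eta^(1/p) <= C eta^(1/q)] for all small [eta],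
which fails as [q < p] ([ell_norm_not_embeds_smaller]).

Snowflakes. If [p < r], a Lipschitz map into [(ell_p, d_p)] of a line with the
metric [|s - t|^r] has coordinates that are Hoelder of exponent [r/p > 1],
hence constant ([snowflake_path_not_embeds]). The lines of [(ell_q, d_q)] have
[r = q], those of a norm have [r = 1].

Assouad's embedding, for [p < q <= 1]. The chirps
[2^(j p/q) cos (2^(-j) t)] and [2^(j p/q) sin (2^(-j) t)], for [j] an integer,
embed the line with [|s - t|^p] into [ell_q] with [d_q]: the scales [2^j] far
from [|s - t|] contribute two geometric series, and the scale next to
[|s - t|] gives the lower bound. Applying this embedding in each coordinate
embeds [(ell_p, d_p)] ([coordinatewise_embeds]). *)

(** * Power sums *)

Lemma mem_leq_sumn (s : seq nat) n : n \in s -> (n <= sumn s)%N.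
Proof.
elim: s => //= m s IH; rewrite inE.
by case/predU1P=> [->|/IH h]; [exact: leq_addr|exact: leq_trans h (leq_addl _ _)].
Qed.

Lemma sum_nat_split (R : realType) (f : nat -> R) N M : (forall i, 0 <= f i) ->
  \sum_(0 <= i < M) f i <= \sum_(0 <= i < N) f i + \sum_(N <= i < M) f i.
Proof.
move=> f0; have [NM|/ltnW MN] := leqP N M; first by rewrite -big_cat_nat.
rewrite [X in _ + X]big_geq// addr0 (@big_cat_nat _ _ _ M 0%N N)//=.
by rewrite lerDl sumr_ge0.
Qed.

Lemma sum_powR_triangle (R : realType) (q : R) (x y z : nat -> R) N M : 0 < q ->
  \sum_(N <= i < M) `|x i - z i| `^ q <=
  2 `^ q * (\sum_(N <= i < M) `|x i - y i| `^ q +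
            \sum_(N <= i < M) `|y i - z i| `^ q).
Proof.
move=> q0; rewrite -big_split mulr_sumr; apply: ler_sum => i _.
apply: le_trans (powRD_le q0 _ _) => //.
rewrite ge0_ler_powR ?nnegrE ?addr_ge0//; first exact: ltW.
by rewrite (le_trans _ (ler_normD _ _))// addrA subrK.
Qed.

Section PowerSums.
Variables (R : realType) (p : R) (p0 : 0 < p).
Implicit Types x y z : ell p.

Lemma psum_partial x y N :
  \sum_(0 <= i < N) `|x i - y i| `^ p <= ell_psum x y.
Proof.
have -> : \sum_(0 <= i < N) `|x i - y i| `^ p =
    series (fun n => `|x n - y n| `^ p) N by rewrite seriesEnat.
apply: nondecreasing_cvgn_le; last exact: ell_cvg.
apply/nondecreasing_seqP => k.
by rewrite !seriesEnat /= big_nat_recr//= lerDl powR_ge0.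
Qed.

Lemma psum_le x y c :
  (forall N, \sum_(0 <= i < N) `|x i - y i| `^ p <= c) -> ell_psum x y <= c.
Proof.
move=> h; apply: limr_le; first exact: ell_cvg.
by apply: nearW => N; rewrite seriesEnat; exact: h.
Qed.

Lemma summable_bounded (u : nat -> R) c :
  (forall N, \sum_(0 <= i < N) `|u i| `^ p <= c) ->
  cvgn (series (fun n => `|u n| `^ p)).
Proof.
move=> h; apply: nondecreasing_is_cvgn.
  apply/nondecreasing_seqP => k.
  by rewrite !seriesEnat /= big_nat_recr//= lerDl powR_ge0.
by exists c => _ [N _ <-]; rewrite seriesEnat; exact: h.
Qed.

Lemma psum_tail x y N M :
  \sum_(0 <= i < N) `|x i - y i| `^ p + \sum_(N <= i < M) `|x i - y i| `^ p
  <= ell_psum x y.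
Proof.
have [NM|/ltnW MN] := leqP N M.
  by rewrite -big_cat_nat//= psum_partial.
by rewrite [X in _ + X]big_geq// addr0 psum_partial.
Qed.

Lemma psum_head x y e : 0 < e ->
  exists N, ell_psum x y <= \sum_(0 <= i < N) `|x i - y i| `^ p + e.
Proof.
move=> e0; apply: contrapT => /forallNP h.
suff : ell_psum x y <= ell_psum x y - e by rewrite lerBrDr gerDl leNgt e0.
apply: psum_le => N; have /negP := h N.
by rewrite -ltNge -ltrBrDr => /ltW.
Qed.

Lemma psum_quasi_triangle y x z :
  ell_psum x z <= 2 `^ p * (ell_psum x y + ell_psum y z).
Proof.
apply: psum_le => N; apply: le_trans (sum_powR_triangle x y z 0 N p0) _.
by rewrite ler_wpM2l ?powR_ge0// lerD// psum_partial.
Qed.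

Definition ell_sub x y : ell p := Ell (@ell_cvg R p p0 x y).

Lemma ell0_summable :
  cvgn (series (fun n : nat => `|(fun=> 0 : R) n| `^ p)).
Proof.
apply: (@summable_bounded _ 0) => N.
by rewrite big1// => i _; rewrite normr0 powR0 ?gt_eqF.
Qed.

Definition ell0 : ell p := Ell ell0_summable.

Lemma spike_sum_le n (r : R) N :
  \sum_(0 <= i < N) `|if i == n then r else 0| `^ p <= `|r| `^ p.
Proof.
have h (i : nat) : (i != n) -> `|if i == n then r else 0| `^ p = 0.
  by move=> /negPf ->; rewrite normr0 powR0 ?gt_eqF.
rewrite big_nat; have [nN|Nn] := ltnP n N; last first.
  rewrite big1 ?powR_ge0// => i /andP[_ iN]; apply: h.
  by rewrite neq_ltn (leq_trans iN Nn).
rewrite -big_nat big_mkord (bigD1 (Ordinal nN))//= eqxx big1 ?addr0// => i ni.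
by apply: h; apply: contra ni => /eqP ni; apply/eqP/val_inj.
Qed.

Lemma spike_summable n (r : R) :
  cvgn (series (fun i => `|(fun i : nat => if i == n then r else 0) i| `^ p)).
Proof. exact: (summable_bounded (spike_sum_le n r)). Qed.

Definition spike n r : ell p := Ell (@spike_summable n r).

Lemma psum_spike0 n r : ell_psum (spike n r) ell0 <= `|r| `^ p.
Proof.
apply: psum_le => N; apply: le_trans (spike_sum_le n r N).
by apply: ler_sum => i _; rewrite subr0.
Qed.

(** Lower bounds on distances are obtained by selecting coordinates. *)
Lemma psum_seq x y (s : seq nat) : uniq s ->
  \sum_(i <- s) `|x i - y i| `^ p <= ell_psum x y.
Proof.
move=> us; pose N := (sumn s).+1.
have sN i : i \in s -> (i < N)%N.
  by rewrite ltnS; exact: mem_leq_sumn.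
have sE : perm_eq s [seq i <- index_iota 0 N | i \in s].
  apply: uniq_perm => //; first by rewrite filter_uniq ?iota_uniq.
  move=> i; rewrite mem_filter mem_index_iota /=.
  by case: (boolP (i \in s)) => // /sN ->.
rewrite (perm_big _ sE) big_filter; apply: le_trans (psum_partial x y N).
rewrite [leRHS](bigID (fun i => i \in s))/= lerDl.
by rewrite sumr_ge0// => i _; exact: powR_ge0.
Qed.

End PowerSums.

(** * Coordinatewise limits along ultrafilters *)

Lemma powR_continuous (R : realType) (q l : R) : 0 < q -> 0 < l ->
  {for l, continuous (fun x : R => x `^ q)}.
Proof.
move=> q0 l0; apply: differentiable_continuous; apply/derivable1_diffP.
by apply: derivable_powR; rewrite in_itv/= l0.
Qed.

Lemma cvg_norm_powR (R : realType) (T : Type) (F : set_system T)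
    {FF : Filter F} (f : T -> R) (l q : R) : 0 < q ->
  f t @[t --> F] --> l -> `|f t| `^ q @[t --> F] --> `|l| `^ q.
Proof.
move=> q0 fl; have [l0|l0] := eqVneq l 0; last first.
  apply: (@continuous_cvg _ _ _ _ _ (fun t => `|f t|) (fun x : R => x `^ q)).
    by apply: powR_continuous => //; rewrite normr_gt0.
  exact: cvg_norm.
rewrite l0 normr0 powR0 ?gt_eqF//; apply/cvgrPdist_lt => e e0.
have eq0 : 0 < e `^ q^-1 by rewrite powR_gt0.
apply: filterS (cvgr_dist_lt _ _ fl _ eq0) => t.
rewrite l0 !sub0r !normrN (ger0_norm (powR_ge0 _ _)) => h.
have : `|f t| `^ q < (e `^ q^-1) `^ q by rewrite gt0_ltr_powR ?nnegrE ?powR_ge0.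
by rewrite -powRrM mulVf ?gt_eqF// powRr1// ltW.
Qed.

Lemma cvg_psum_head (R : realType) (T : Type) (F : set_system T)
    {FF : Filter F} (q : R) (u w : T -> nat -> R) (v z : nat -> R) N : 0 < q ->
  (forall i, u t i @[t --> F] --> v i) -> (forall i, w t i @[t --> F] --> z i) ->
  \sum_(0 <= i < N) `|u t i - w t i| `^ q @[t --> F] -->
  \sum_(0 <= i < N) `|v i - z i| `^ q.
Proof.
move=> q0 uv wz.
apply: (@cvg_big R nat +%R 0 xpredT _ T F (index_iota 0 N)
  (fun i t => `|u t i - w t i| `^ q)) => [x|i _].
  exact: (@add_continuous R^o x).
by apply: cvg_norm_powR => //; apply: cvgB.
Qed.

Lemma cvg_le_bound (R : realType) (T : Type) (F : set_system T)
    {FF : ProperFilter F} (f : T -> R) (l c : R) :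
  f t @[t --> F] --> l -> (\forall t \near F, f t <= c) -> l <= c.
Proof.
move=> fl fc; rewrite -(cvg_lim (@Rhausdorff R) fl).
by apply: limr_le => //; apply/cvg_ex; exists l.
Qed.

(** Each partial sum passes to the limit; the tails may lose mass, hence only an
inequality. *)
Lemma psum_lsc (R : realType) (T : Type) (F : set_system T)
    {FF : ProperFilter F} (q : R) (u w : T -> ell q) (v z : ell q) c : 0 < q ->
  (forall i, u t i @[t --> F] --> v i) -> (forall i, w t i @[t --> F] --> z i) ->
  (\forall t \near F, ell_psum (u t) (w t) <= c) -> ell_psum v z <= c.
Proof.
move=> q0 uv wz uwc; apply: psum_le => // N.
apply: (cvg_le_bound (cvg_psum_head (N := N) q0 uv wz)).
by apply: filterS uwc => t; apply: le_trans; exact: psum_partial.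
Qed.

(** The image of [U] on the compact interval [[- b, b]] has a cluster point. As
[U] contains each set or its complement, clustering at a point forces
convergence to it. *)
Lemma ultra_bounded_cvg (R : realType) (T : Type) (U : set_system T)
    {UU : UltraFilter U} (c : T -> R) b : (forall t, `|c t| <= b) ->
  exists l : R, c t @[t --> U] --> l.
Proof.
move=> cb.
have [|l [_ cl]] := @segment_compact R (- b) b (c t @[t --> U]) _.
  by apply: nearW => t /=; rewrite in_itv/= -ler_norml.
exists l; apply/cvgrPdist_lt => e e0.
have [//|nU] := in_ultra_setVsetC [set t | `|l - c t| < e] UU.
have [x [/= x1 x2]] := cl (~` ball l e) (ball l e) nU (nbhsx_ballx _ _ e0).
by [].
Qed.

(** Bounded sets of [ell q] are compact for coordinatewise convergence; using an
ultrafilter avoids extracting diagonal subsequences, and makes the limit a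
function of the family. *)
Lemma ell_ultra_limit (R : realType) (q : R) (T : Type) (U : set_system T)
    {UU : UltraFilter U} (u : T -> ell q) a c : 0 < q ->
  (forall t, ell_psum (u t) a <= c) ->
  exists v : ell q, forall i, u t i @[t --> U] --> v i.
Proof.
move=> q0 uc.
have ui i : exists l : R, u t i @[t --> U] --> l.
  apply: (@ultra_bounded_cvg _ _ U UU _ (c `^ q^-1 + `|a i|)) => t.
  rewrite -[u t i](subrK (a i)) (le_trans (ler_normD _ _))// lerD2r.
  have := le_trans (ell_psum_ge q0 (u t) a i) (uc t) => h.
  rewrite -[leLHS]powRr1// -(mulfV (lt0r_neq0 q0)) powRrM.
  by rewrite ge0_ler_powR ?nnegrE ?invr_ge0 ?powR_ge0 ?(ltW q0)//
    (le_trans (powR_ge0 _ _) h).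
have [v uv] := choice ui.
suff sv : cvgn (series (fun n => `|v n| `^ q)) by exists (Ell sv).
apply: (@summable_bounded _ _ _ (2 `^ q * (c + ell_psum a (ell0 q0)))) => N.
have -> : \sum_(0 <= i < N) `|v i| `^ q =
    \sum_(0 <= i < N) `|v i - ell0 q0 i| `^ q.
  by apply: eq_bigr => i _; rewrite subr0.
apply: (cvg_le_bound (cvg_psum_head (w := fun=> ell0 q0) q0 uv
  (fun i => cvg_cst _))).
apply: nearW => t; apply: le_trans (psum_partial q0 _ _ _) _.
apply: le_trans (psum_quasi_triangle q0 a _ _) _.
by rewrite ler_wpM2l ?powR_ge0// lerD2r.
Qed.

(** * Concentration of maps into [ell q] *)

(** [u t - v] tends to 0 in each coordinate, so that asymptotically it has no
mass on the finitely many coordinates that carry [v - w]: the power sums of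
[u t - v] and [v - w] nearly add up. The crude constant [2 `^ q] is harmless,
because it does not multiply [ell_psum v w]. *)
Lemma psum_near_limit (R : realType) (q : R) (T : Type) (F : set_system T)
    {FF : Filter F} (u : T -> ell q) (v w : ell q) L : 0 < q ->
  (forall i, u t i @[t --> F] --> v i) -> (forall t, ell_psum (u t) v <= L) ->
  \forall t \near F,
    ell_psum (u t) w <= ell_psum v w + (2 `^ q * (L + 1) + 1).
Proof.
move=> q0 uv uL; have [N hN] := psum_head q0 v w ltr01.
have hw : \forall t \near F, \sum_(0 <= i < N) `|u t i - w i| `^ q <=
    \sum_(0 <= i < N) `|v i - w i| `^ q + 1.
  apply: (cvgr_le _ (cvg_psum_head (w := fun=> w) q0 uv (fun i => cvg_cst _))).
  by rewrite ltrDl.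
apply: filterS hw => t ht; apply: psum_le => // M.
apply: le_trans (sum_nat_split N _ _) _ => [i|]; first exact: powR_ge0.
have tail_u : \sum_(N <= i < M) `|u t i - v i| `^ q <= L.
  apply: le_trans (uL t); apply: le_trans (psum_tail q0 _ _ N M).
  by rewrite lerDr sumr_ge0// => i _; exact: powR_ge0.
have tail_v : \sum_(N <= i < M) `|v i - w i| `^ q <= 1.
  by rewrite -(lerD2l (\sum_(0 <= i < N) `|v i - w i| `^ q))
    (le_trans (psum_tail q0 _ _ _ _)).
have tail_w := le_trans (sum_powR_triangle (u t) v w N M q0)
  (ler_wpM2l (powR_ge0 _ _) (lerD tail_u tail_v)).
apply: le_trans (lerD ht tail_w) _.
have := psum_partial q0 v w N; lra.
Qed.

Section Concentration.
Variables (R : realType) (q L : R) (q0 : 0 < q).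
Variables (X : Type) (a : nat -> X -> X).
Hypothesis aC : forall n m x, a n (a m x) = a m (a n x).

Let small_steps (G : X -> ell q) :=
  forall x n m, ell_psum (G (a n x)) (G (a m x)) <= L.

(** [H x] is the coordinatewise limit of [G (a n x)]. Commutativity of the moves
turns [H (a n x)] and [H (a m x)] into limits of points [G (a n y)] and
[G (a m y)] with [y = a j x], so [H] inherits the small steps of [G] and the
construction can be iterated. *)
Lemma asymptotic_limit (G : X -> ell q) : small_steps G ->
  exists H : X -> ell q, small_steps H /\ forall x w N, exists2 n, (N <= n)%N &
    ell_psum (G (a n x)) w <= ell_psum (H x) w + (2 `^ q * (L + 1) + 1).
Proof.
move=> GL; have [U [UU ooU]] := ultraFilterLemma (F := \oo : set_system nat) _.
have lim x : exists v : ell q, forall i, G (a n x) i @[n --> U] --> v i.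
  exact: (ell_ultra_limit q0 (fun n => GL x n 0%N)).
have [H GH] := choice lim.
have GHL x n : ell_psum (G (a n x)) (H x) <= L.
  apply: (psum_lsc q0 (fun i => cvg_cst _) (GH x)).
  by apply: nearW => m; exact: GL.
exists H; split=> [x n m|x w N].
  apply: (psum_lsc q0 (GH _) (GH _)).
  by apply: nearW => j; rewrite !(aC j); exact: GL.
have near_n : \forall n \near U,
    ell_psum (G (a n x)) w <= ell_psum (H x) w + (2 `^ q * (L + 1) + 1).
  exact: (psum_near_limit w q0 (GH x) (GHL x)).
have far_n : \forall n \near U, (N <= n)%N by apply/ooU/nbhs_infty_ge.
have [n [Nn hn]] : exists n, (N <= n)%N /\
    ell_psum (G (a n x)) w <= ell_psum (H x) w + (2 `^ q * (L + 1) + 1).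
  apply: (@filter_ex _ U); near=> n.
  by split; near: n.
by exists n.
Unshelve. all: by end_near.
Qed.

(** The point [H x] is independent of [s], and the cost is linear in [k] for
the power sum: a distance of order [k^(1/q)] after [k] moves of bounded
length. *)
Lemma concentration k (G : X -> ell q) : small_steps G ->
  exists H : X -> ell q, small_steps H /\ forall x w N, exists s : seq nat,
    [/\ size s = k, uniq s, all (leq N) s &
      ell_psum (G (foldl (fun x n => a n x) x s)) w <=
      ell_psum (H x) w + k%:R * (2 `^ q * (L + 1) + 1)].
Proof.
move=> GL; elim: k => [|k [H [HL HG]]].
  by exists G; split=> // x w N; exists [::]; rewrite mul0r addr0.
(* The first move goes from [H' x] to [H (a n x)]; the induction hypothesis at
   [a n x] makes the [k] others, beyond [n]. *)
have [H' [HL' HH']] := asymptotic_limit HL.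
exists H'; split=> // x w N; have [n Nn hn] := HH' x w N.
have [s [sk us sn hs]] := HG (a n x) w n.+1.
exists (n :: s); split => /=; first by rewrite sk.
- rewrite us andbT; apply/negP => /(allP sn).
  by rewrite ltnn.
- by rewrite Nn; apply: sub_all sn => m /ltnW; exact: leq_trans.
- apply: le_trans hs _.
  by rewrite -[k.+1%:R]nat1r mulrDl mul1r addrA lerD2r.
Qed.

End Concentration.

Lemma powR_superlinear (R : realType) (e K : R) (k0 : nat) : 1 < e ->
  ~ (forall k : nat, (k0 <= k)%N -> k%:R `^ e <= K * k%:R).
Proof.
move=> e1 h; have r0 : 0 < e - 1 by rewrite subr_gt0.
pose t := (`|K| + 1) `^ (e - 1)^-1.
have t0 : 0 < t by rewrite powR_gt0// ltr_wpDl.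
pose k := (k0 + (Num.truncn t).+1)%N.
have tk : t < k%:R by rewrite (lt_le_trans (truncnS_gt t))// ler_nat leq_addl.
have kp : 0 < k%:R :> R := lt_trans t0 tk.
have := h k (leq_addr _ _); rewrite -[in leLHS](subrK 1 e).
rewrite powRD ?(gt_eqF kp) ?implybT//.
rewrite powRr1 ?ler0n// ler_pM2r// => kK.
have : t `^ (e - 1) < k%:R `^ (e - 1).
  by rewrite gt0_ltr_powR// nnegrE (ltW t0, ltW kp).
rewrite -powRrM mulVf ?gt_eqF// powRr1 ?addr_ge0// => Kk.
have := ler_norm K; lra.
Qed.

Lemma mdist_norm_powR (R : realType) (q : R) (q1 : 1 <= q) (x y : ell_norm q1) :
  mdist x y `^ q = ell_psum x y.
Proof.
have q0 : 0 < q := lt_le_trans ltr01 q1.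
rewrite /mdist/= /ell_norm_dist -powRrM mulVf ?gt_eqF// powRr1//.
exact: ell_psum_ge0.
Qed.

(** Two disjoint sequences of [k] moves, the second beyond the first, whose
images are both close to the same [H o], contradict the growth hypothesis for
large [k]. *)
Lemma spread_not_embeds (R : realType) (M : metricType R) (a : nat -> M -> M)
    (o : M) (D theta q : R) (q1 : 1 <= q) :
  (forall n m x, a n (a m x) = a m (a n x)) ->
  (forall n m x, mdist (a n x) (a m x) <= D) ->
  (forall s s' : seq nat, uniq (s ++ s') -> size s = size s' ->
    (size s)%:R `^ theta <= mdist (foldl (fun x n => a n x) o s)
                                  (foldl (fun x n => a n x) o s')) ->
  1 < theta * q -> ~ lipschitz_embeds M (ell_norm q1).
Proof.
move=> aC aD growth thq [f [_ [A [B [A0 B0 fAB]]]]].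
have q0 : 0 < q := lt_le_trans ltr01 q1.
pose L := (B * D) `^ q.
have fL x n m : ell_psum (f (a n x)) (f (a m x)) <= L.
  rewrite -mdist_norm_powR ge0_ler_powR ?nnegrE ?mdist_ge0 ?(ltW q0)//.
    rewrite mulr_ge0 ?(ltW B0)//.
    by apply: le_trans (aD 0%N 0%N o); rewrite mdist_ge0.
  have /andP[_ h] := fAB (a n x) (a m x).
  by apply: le_trans h _; rewrite ler_pM2l.
pose C := 2 `^ q * (L + 1) + 1.
apply: (@powR_superlinear _ _ (A `^ q * (2 `^ q * (C + C))) 0%N thq) => k _.
have [H [_ HH]] := concentration q0 aC k fL.
have [s [sk us _ hs]] := HH o (H o) 0%N.
have [s' [sk' us' ss' hs']] := HH o (H o) (sumn s).+1.
have uss : uniq (s ++ s').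
  rewrite cat_uniq us us' andbT; apply/hasPn => n /(allP ss') ns.
  by apply/negP => /= /mem_leq_sumn; rewrite leqNgt ns.
have := growth _ _ uss; rewrite sk sk' => /(_ erefl).
set x := foldl _ _ s; set y := foldl _ _ s' => kxy.
have /andP[Axy _] := fAB x y.
have AfM : k%:R `^ theta <= A * mdist (f x) (f y).
  by apply: le_trans kxy _; rewrite -ler_pdivrMl.
rewrite powRrM (@le_trans _ _ ((A * mdist (f x) (f y)) `^ q))//.
  by rewrite ge0_ler_powR ?nnegrE ?powR_ge0 ?(ltW q0)//
    mulr_ge0 ?mdist_ge0// ltW.
rewrite powRM ?mdist_ge0 ?(ltW A0)// mdist_norm_powR -!mulrA.
rewrite ler_wpM2l ?powR_ge0//.
apply: le_trans (psum_quasi_triangle q0 (H o) _ _) _.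
rewrite ler_wpM2l ?powR_ge0// mulrDl; apply: lerD.
  by apply: le_trans hs _; rewrite ell_psumxx// add0r mulrC.
by rewrite ell_psumC; apply: le_trans hs' _; rewrite ell_psumxx// add0r mulrC.
Qed.

Section UnitMoves.
Variables (R : realType) (p : R) (p0 : 0 < p).

(* The moves subtract a unit vector: two of them differ by two spikes. *)
Let a n (x : ell p) : ell p := ell_sub p0 x (spike p0 n 1).
Let o : ell p := ell0 p0.

Let aC n m x : a n (a m x) = a m (a n x).
Proof. by apply: ellP => i /=; rewrite addrAC. Qed.

Let aD n m x : ell_psum (a n x) (a m x) <= 2 `^ p * 2.
Proof.
have -> : ell_psum (a n x) (a m x) = ell_psum (spike p0 m 1) (spike p0 n 1).
  rewrite /ell_psum; congr (limn (series _)); apply/funext => i /=.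
  by congr (`|_| `^ p); rewrite opprB addrC addrA subrK.
apply: le_trans (psum_quasi_triangle p0 o _ _) _.
rewrite ler_wpM2l ?powR_ge0// [ell_psum o _]ell_psumC.
have h k := psum_spike0 p0 k (1 : R).
have := lerD (h m) (h n); rewrite normr1 powR1.
by move/le_trans; apply.
Qed.

Let aE s x i : foldl (fun x n => a n x) x s i = x i - (count_mem i s)%:R.
Proof.
elim: s x => [|n s IH] x /=; first by rewrite subr0.
rewrite IH /= natrD eq_sym [in RHS]opprD addrA; congr (_ - _ - _).
by case: (n == i).
Qed.

Let growth (s s' : seq nat) : uniq (s ++ s') ->
  (size s)%:R <= ell_psum (foldl (fun x n => a n x) o s)
                          (foldl (fun x n => a n x) o s').
Proof.
rewrite cat_uniq => /and3P[us /hasPn ss' us'].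
apply: le_trans (psum_seq p0 _ _ us).
rewrite big_seq (eq_bigr (fun=> 1)) => [|i si].
  by rewrite -big_seq big_const_seq count_predT iter_addr_0.
rewrite !aE !sub0r (count_uniq_mem _ us) si (count_uniq_mem _ us').
have /negPf -> : i \notin s' by apply/negP => /ss'; rewrite si.
by rewrite oppr0 subr0 normrN normr1 powR1.
Qed.

Lemma ell_norm_not_embeds_larger (p1 : 1 <= p) (q : R) (q1 : 1 <= q) :
  p < q -> ~ lipschitz_embeds (ell_norm p1) (ell_norm q1).
Proof.
move=> pq.
apply: (@spread_not_embeds _ (ell_norm p1) a o ((2 `^ p * 2) `^ p^-1) p^-1) => //.
- move=> n m x; apply: ge0_ler_powR; rewrite ?nnegrE ?invr_ge0 ?(ltW p0)//.
  + exact: ell_psum_ge0.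
- move=> s s' uss _; apply: ge0_ler_powR; rewrite ?nnegrE ?invr_ge0 ?(ltW p0)//.
  + exact: ell_psum_ge0.
  + exact: growth.
- by rewrite mulrC ltr_pdivlMr// mul1r.
Qed.

(** For [d_p] the distance of two disjoint sets of [k] moves is [2 k], whatever
[p]: the metric behaves like that of [ell_1]. *)
Lemma ell_dp_not_embeds_norm (p01 : 0 < p <= 1) (q : R) (q1 : 1 <= q) :
  1 < q -> ~ lipschitz_embeds (ell_dp p01) (ell_norm q1).
Proof.
move=> q1'.
apply: (@spread_not_embeds _ (ell_dp p01) a o (2 `^ p * 2) 1) => //.
- by move=> s s' uss _; rewrite powRr1//; exact: growth.
- by rewrite mul1r.
Qed.

End UnitMoves.

(** * Maps into snowflakes *)

(** Cut [[0, 1]] into [N] intervals: the increments add up to at most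
[N * B * N^(-e)], which tends to 0. *)
Lemma holder_endpoints (R : realType) (g : R -> R) (B e : R) : 1 < e ->
  (forall s t, `|g s - g t| <= B * `|s - t| `^ e) -> g 0 = g 1.
Proof.
move=> e1 gB; apply/eqP; rewrite eq_sym -subr_eq0 -normr_eq0; apply: contrapT.
move=> /negP d0.
have {}d0 : 0 < `|g 1 - g 0| by rewrite lt_def d0 normr_ge0.
apply: (@powR_superlinear _ _ (B / `|g 1 - g 0|) 1%N e1) => -[//|n _].
set N := n.+1; have N0 : 0 < N%:R :> R by rewrite ltr0n.
rewrite mulrAC ler_pdivlMr// mulrC -ler_pdivlMr ?powR_gt0//.
have -> : g 1 - g 0 = \sum_(0 <= i < N) (g (i.+1%:R / N%:R) - g (i%:R / N%:R)).
  by rewrite telescope_sumr// mul0r divff// gt_eqF.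
apply: le_trans (ler_norm_sum _ _ _) _.
have -> : B * N%:R / N%:R `^ e = \sum_(0 <= i < N) B / N%:R `^ e.
  by rewrite sumr_const_nat subn0 -[RHS]mulr_natr mulrAC.
apply: ler_sum => i _; apply: le_trans (gB _ _) _.
rewrite -mulrBl -(natr1 i) addrAC subrr add0r mul1r.
rewrite -[in leRHS]powRN ger0_norm ?invr_ge0 ?ler0n//.
by rewrite -powR_inv1 ?ler0n// -powRrM mulN1r.
Qed.

Lemma snowflake_path_not_embeds (R : realType) (M : metricType R)
    (gamma : R -> M) (p r : R) (p01 : 0 < p <= 1) :
  (forall s t, mdist (gamma s) (gamma t) = `|s - t| `^ r) -> p < r ->
  ~ lipschitz_embeds M (ell_dp p01).
Proof.
move=> gammaE pr [f [finj [A [B [A0 B0 fAB]]]]].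
have /andP[p0 _] := p01.
have : f (gamma 0) = f (gamma 1).
  apply: ellP => i.
  apply: (@holder_endpoints _ (fun t => f (gamma t) i) (B `^ p^-1) (r / p)).
    by rewrite ltr_pdivlMr// mul1r.
  move=> s t; rewrite powRrM -powRM ?powR_ge0 ?(ltW B0)//.
  rewrite -[leLHS]powRr1// -(mulfV (lt0r_neq0 p0)) powRrM.
  rewrite ge0_ler_powR ?nnegrE ?invr_ge0 ?(ltW p0) ?mulr_ge0 ?powR_ge0 ?(ltW B0)//.
  apply: le_trans (ell_psum_ge p0 _ _ i) _.
  by have /andP[_] := fAB (gamma s) (gamma t); rewrite gammaE.
move=> /finj g01; have := gammaE 0 1.
by rewrite g01 mdistxx sub0r normrN normr1 powR1 => /esym/eqP; rewrite oner_eq0.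
Qed.

Lemma psum_spike2 (R : realType) (q : R) (q0 : 0 < q) n (s t : R) :
  ell_psum (spike q0 n s) (spike q0 n t) = `|s - t| `^ q.
Proof.
apply/eqP; rewrite eq_le; apply/andP; split; last first.
  by have := ell_psum_ge q0 (spike q0 n s) (spike q0 n t) n; rewrite /= eqxx.
apply: psum_le => // N; apply: le_trans (spike_sum_le q0 n (s - t) N).
by apply: ler_sum => i _ /=; case: eqP; rewrite ?subr0.
Qed.

Lemma ell_norm_not_embeds_dp (R : realType) (p q : R) (p01 : 0 < p <= 1)
  (q1 : 1 <= q) : p < 1 -> ~ lipschitz_embeds (ell_norm q1) (ell_dp p01).
Proof.
have q0 : 0 < q := lt_le_trans ltr01 q1.
apply: (@snowflake_path_not_embeds _ (ell_norm q1) (spike q0 0%N)) => s t.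
rewrite /mdist/= /ell_norm_dist psum_spike2 -powRrM mulfV ?gt_eqF//.
Qed.

Lemma ell_dp_not_embeds_smaller (R : realType) (p q : R) (p01 : 0 < p <= 1)
  (q01 : 0 < q <= 1) : p < q -> ~ lipschitz_embeds (ell_dp q01) (ell_dp p01).
Proof.
have /andP[q0 _] := q01.
apply: (@snowflake_path_not_embeds _ (ell_dp q01) (spike q0 0%N)) => s t.
exact: psum_spike2.
Qed.

(** * Approximate midpoints *)

Section MidpointsSource.
Variables (R : realType) (p : R) (p0 : 0 < p).

Lemma ell_scale_summable (c : R) (x : ell p) :
  cvgn (series (fun i => `|(fun i : nat => c * x i) i| `^ p)).
Proof.
apply: (@summable_bounded _ _ _ (`|c| `^ p * ell_psum x (ell0 p0))) => N.
apply: (le_trans _ (ler_wpM2l (powR_ge0 _ _) (psum_partial p0 x _ N))).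
rewrite mulr_sumr; apply: ler_sum => i _.
by rewrite subr0 normrM powRM.
Qed.

Definition ell_scale c x : ell p := Ell (@ell_scale_summable c x).

(** Adding a spike of height [r] to the midpoint costs [r^p] in the power sum,
against the main term [2^(-p) * ell_psum x y], so a relative error [eta] leaves
room for [r] of order [eta^(1/p)]. *)
Lemma spread_midpoints (eta : R) (x y : ell p) : 0 < eta -> 0 < ell_psum x y ->
  exists z : nat -> ell p,
    [/\ forall n, ell_psum (z n) x <= (1 + eta) * (2^-1 `^ p * ell_psum x y),
        forall n, ell_psum (z n) y <= (1 + eta) * (2^-1 `^ p * ell_psum x y) &
        forall n m, n != m ->
          4^-1 `^ p * (eta * ell_psum x y) <= ell_psum (z n) (z m)].
Proof.
move=> eta0 D0; pose w := ell_scale 2^-1 (ell_sub p0 x y).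
(* The factor 4 leaves room for the [n]-th coordinate of [w], which is at most
   [r] for large [n]. *)
have [r r0 rp] : exists2 r : R, 0 < r &
    r `^ p = 4^-1 `^ p * (eta * ell_psum x y).
  exists (4^-1 * (eta * ell_psum x y) `^ p^-1).
    by rewrite mulr_gt0// powR_gt0// mulr_gt0.
  rewrite (@powRM _ 4^-1) ?powR_ge0// -powRrM mulVf ?gt_eqF// powRr1//.
  by rewrite mulr_ge0 ?(ltW D0) ?(ltW eta0).
have r2p : `|2 * r| `^ p = eta * (2^-1 `^ p * ell_psum x y).
  rewrite ger0_norm ?mulr_ge0 ?(ltW r0)// (@powRM _ 2) ?(ltW r0)// rp mulrA.
  by rewrite -powRM// (_ : 2 * 4^-1 = 2^-1 :> R); [rewrite mulrCA|lra].
have [N0 hN0] : exists N0, forall n, (N0 <= n)%N -> `|w n| <= r.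
  have := cvg_series_cvg_0 (@ell_summable _ _ w) => /cvgr_lt /(_ (r `^ p)).
  rewrite powR_gt0// => /(_ isT) [N0 _ hN0]; exists N0 => n /hN0 /= wr.
  rewrite leNgt; apply/negP => rw; move: wr; rewrite ltNge => /negP; apply.
  by rewrite ge0_ler_powR ?nnegrE ?(ltW p0) ?(ltW r0) ?(ltW rw).
have bound (v : nat -> R) n N : (forall i, `|v i| = `|w i|) -> (N0 <= n)%N ->
    \sum_(0 <= i < N) `|v i - (if i == n then r else 0)| `^ p <=
    (1 + eta) * (2^-1 `^ p * ell_psum x y).
  move=> vw Nn; rewrite mulrDl mul1r -r2p.
  apply: le_trans (lerD (ler_wpM2l (powR_ge0 _ _) (psum_partial p0 x y N))
    (spike_sum_le p0 n (2 * r) N)).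
  rewrite mulr_sumr -big_split; apply: ler_sum => i _ /=.
  have wi : `|v i| `^ p = 2^-1 `^ p * `|x i - y i| `^ p.
    by rewrite vw /= normrM powRM// ger0_norm.
  case: eqP => [->|_]; last by rewrite subr0 wi lerDl powR_ge0.
  rewrite (@le_trans _ _ (`|2 * r| `^ p)) ?lerDr ?mulr_ge0 ?powR_ge0//.
  rewrite ge0_ler_powR ?nnegrE ?(ltW p0)//.
  rewrite (le_trans (ler_normB _ _))// vw (ger0_norm (ltW r0)).
  rewrite (@ger0_norm _ (2 * r)) ?mulr_ge0 ?(ltW r0)//; have := hN0 n Nn; lra.
exists (fun n => ell_sub p0 (ell_sub p0 x w) (spike p0 (N0 + n)%N r)); split.
- move=> n; apply: psum_le => // N.
  apply: le_trans (bound (fun i => - w i) (N0 + n)%N N _ (leq_addr _ _)).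
    apply: ler_sum => i _ /=; rewrite le_eqVlt; apply/orP; left; apply/eqP.
    by congr (`|_| `^ p); ring.
  by move=> i; rewrite normrN.
- move=> n; apply: psum_le => // N.
  apply: le_trans (bound w (N0 + n)%N N _ (leq_addr _ _)) => //.
  apply: ler_sum => i _ /=; rewrite le_eqVlt; apply/orP; left; apply/eqP.
  by congr (`|_| `^ p); field.
- move=> n m nm; rewrite -rp.
  apply: le_trans (ell_psum_ge p0 _ _ (N0 + n)%N) => /=.
  rewrite eqxx eqn_add2l (negPf nm) subr0 addrAC subrr sub0r normrN.
  by rewrite ge0_ler_powR ?nnegrE ?(ltW p0) ?(ltW r0) ?ger0_norm// (ltW r0).
Qed.

End MidpointsSource.

Lemma powR_half_convex (R : realType) (q s t : R) : 1 <= q ->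
  (2^-1 * `|s + t|) `^ q <= 2^-1 * (`|s| `^ q + `|t| `^ q).
Proof.
move=> q1; have q0 : 0 <= q := le_trans ler01 q1.
apply: (@le_trans _ _ ((2^-1 * `|s| + 2^-1 * `|t|) `^ q)).
  rewrite ge0_ler_powR ?nnegrE ?addr_ge0 ?mulr_ge0//.
  by rewrite -mulrDr ler_wpM2l// ler_normD.
have half : 1 - 2^-1 = 2^-1 :> R by lra.
rewrite mulrDr -{2 4}half.
by apply: (convex_powR q1 (Itv01 _ _)) => //=;
  rewrite ?inE/= ?in_itv/= ?normr_ge0// ?invr_ge0// invf_le1 ?ler1n.
Qed.

Section MidpointsTarget.
Variables (R : realType) (q : R) (q1 : 1 <= q).
Let q0 : 0 < q := lt_le_trans ltr01 q1.

(** By convexity of the power, the average of the power sums of [u - a] and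
[u - b] is at least that of [(a - b) / 2] on any set of coordinates, and also
at least that of [u - (a + b) / 2]. The first bound is used on the head and
the second one on the tail. *)
Lemma midpoint_tail (a b u : ell q) K N M :
  ell_psum u a <= K -> ell_psum u b <= K ->
  2^-1 `^ q * \sum_(0 <= i < N) `|a i - b i| `^ q +
  \sum_(N <= i < M) `|u i - 2^-1 * (a i + b i)| `^ q <= K.
Proof.
move=> ua ub.
have ab i : 2^-1 `^ q * `|a i - b i| `^ q <=
    2^-1 * (`|u i - a i| `^ q + `|u i - b i| `^ q).
  rewrite -powRM// [`|u i - a i|]distrC.
  have := powR_half_convex (a i - u i) (u i - b i) q1.
  by rewrite addrA subrK.
have uc i : `|u i - 2^-1 * (a i + b i)| `^ q <=
    2^-1 * (`|u i - a i| `^ q + `|u i - b i| `^ q).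
  have := powR_half_convex (u i - a i) (u i - b i) q1.
  congr (_ `^ q <= _); rewrite -[in LHS](@ger0_norm _ 2^-1)// -normrM.
  by congr (`|_|); field.
have -> : K = 2^-1 * (K + K) by field.
apply: le_trans (ler_wpM2l _ (lerD (le_trans (psum_tail q0 u a N M) ua)
  (le_trans (psum_tail q0 u b N M) ub))) => //.
rewrite addrACA mulrDr; apply: lerD.
  by rewrite -big_split !mulr_sumr; apply: ler_sum => i _; exact: ab.
by rewrite -big_split mulr_sumr; apply: ler_sum => i _; exact: uc.
Qed.

(** If the head of [a - b] carries nearly all of its mass, the tails of the
approximate midpoints are close to that of [(a + b) / 2], while their heads
accumulate somewhere. Exact midpoints have [K = 2 `^ (- q) * ell_psum a b], for
which the defect [2 `^ q * K - ell_psum a b] vanishes. *)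
Lemma midpoints_cluster (a b : ell q) (u : nat -> ell q) K e :
  0 < e -> (forall n, ell_psum (u n) a <= K) ->
  (forall n, ell_psum (u n) b <= K) ->
  exists n m, n != m /\
    ell_psum (u n) (u m) <= 2 * (2 `^ q * K - ell_psum a b) + e.
Proof.
move=> e0 ua ub.
have [N hN] := psum_head q0 a b (divr_gt0 e0 (ltr0n _ 4)).
have [U [UU ooU]] := ultraFilterLemma (F := \oo : set_system nat) _.
have [v uv] := ell_ultra_limit q0 ua.
pose d : R := 2^-1 `^ q * (e / 4).
have d0 : 0 < d by rewrite mulr_gt0 ?powR_gt0// divr_gt0.
have near_v : \forall n \near U, \sum_(0 <= i < N) `|u n i - v i| `^ q <= d.
  apply: (cvgr_le _ (cvg_psum_head (w := fun=> v) q0 uv (fun i => cvg_cst _))).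
  by rewrite big1// => i _; rewrite subrr normr0 powR0 ?gt_eqF.
have [n hn] := filter_ex near_v.
have [m [nm hm]] : exists m, (n < m)%N /\
    \sum_(0 <= i < N) `|u m i - v i| `^ q <= d.
  have far_n : \forall m \near U, (n < m)%N by apply/ooU/nbhs_infty_gt.
  apply: (@filter_ex _ U); near=> m.
  by split; near: m.
exists n, m; split; first by rewrite neq_ltn nm.
apply: psum_le => // M.
apply: le_trans (sum_nat_split N _ _) _ => [i|]; first exact: powR_ge0.
have head : \sum_(0 <= i < N) `|u n i - u m i| `^ q <= 2 `^ q * (d + d).
  apply: le_trans (sum_powR_triangle (u n) v (u m) 0 N q0) _.
  rewrite ler_wpM2l ?powR_ge0// lerD//.
  by under eq_bigr do rewrite distrC.
have q2 : 2 `^ q * 2^-1 `^ q = 1 :> R by rewrite -powRM// mulfV// powR1.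
have tail k : 2 `^ q * \sum_(N <= i < M) `|u k i - 2^-1 * (a i + b i)| `^ q <=
    2 `^ q * K - ell_psum a b + e / 4.
  have := ler_wpM2l (powR_ge0 2 q) (midpoint_tail N M (ua k) (ub k)).
  by rewrite mulrDr mulrA q2 mul1r; lra.
have tail2 : \sum_(N <= i < M) `|u n i - u m i| `^ q <=
    2 * (2 `^ q * K - ell_psum a b) + e / 2.
  apply: le_trans (sum_powR_triangle (u n) (fun i => 2^-1 * (a i + b i)) (u m)
    N M q0) _.
  rewrite [X in _ * (_ + X) <= _](eq_bigr
    (fun i => `|u m i - 2^-1 * (a i + b i)| `^ q)); last first.
    by move=> i _; rewrite distrC.
  rewrite mulrDr; have := lerD (tail n) (tail m); lra.
have dd : 2 `^ q * (d + d) = e / 2.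
  by rewrite mulrDr /d mulrA q2; field.
by rewrite dd in head; have := lerD head tail2; lra.
Unshelve. all: by end_near. Qed.

End MidpointsTarget.

(** [sigma] is the best Lipschitz constant, a supremum that need not be
attained. *)
Lemma lipschitz_constant (R : realType) (M1 M2 : metricType R) (f : M1 -> M2)
    (A B : R) (x0 y0 : M1) : 0 < A -> x0 != y0 ->
  (forall x y, A^-1 * mdist x y <= mdist (f x) (f y) <= B * mdist x y) ->
  exists2 sigma, 0 < sigma &
    (forall x y, mdist (f x) (f y) <= sigma * mdist x y) /\
    (forall eta, 0 < eta -> exists x y, 0 < mdist x y /\
      (1 - eta) * (sigma * mdist x y) <= mdist (f x) (f y)).
Proof.
move=> A0 xy0 fAB.
pose S := [set r | exists x y,
  0 < mdist x y /\ r = mdist (f x) (f y) / mdist x y].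
have Sub r : S r -> r <= B.
  move=> [x [y [xy ->]]]; rewrite ler_pdivrMr//.
  by have /andP[] := fAB x y.
have S0 : S (mdist (f x0) (f y0) / mdist x0 y0).
  by exists x0, y0; rewrite mdist_gt0.
have supS : has_sup S.
  by split; [eexists; exact: S0 | exists B => r /Sub].
have supP r : S r -> r <= sup S by move=> Sr; exact: ub_le_sup supS.2 _ Sr.
have s0 : 0 < sup S.
  apply: lt_le_trans (supP _ S0).
  rewrite ltr_pdivlMr ?mdist_gt0// mul0r.
  have /andP[h _] := fAB x0 y0; apply: lt_le_trans h.
  by rewrite mulr_gt0 ?invr_gt0// mdist_gt0.
exists (sup S) => //; split=> [x y|eta eta0].
  have [->|xy] := eqVneq x y; first by rewrite !mdistxx mulr0.
  by rewrite -ler_pdivrMr ?mdist_gt0//; apply: supP; exists x, y; rewrite mdist_gt0.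
have [_ [x [y [xy ->]]] h] := sup_adherent (mulr_gt0 eta0 s0) supS.
exists x, y; split=> //; rewrite mulrA -ler_pdivlMr//.
by apply: ltW; apply: le_lt_trans h; rewrite mulrBl mul1r.
Qed.

Lemma powR_linear_bound (R : realType) (q t : R) : 1 <= q -> 0 <= t <= 1 ->
  (1 + t) `^ q <= 1 + (2 `^ q - 1) * t.
Proof.
move=> q1 /andP[t0 t1].
have := convex_powR q1 (Itv01 t0 t1) (x := 2) (y := 1).
rewrite !inE/= !in_itv/= !andbT => /(_ (ler0n _ _) ler01).
rewrite convRE [X in X `^ _ <= _ -> _]convRE /= /unstable.onem powR1 => h.
have -> : 1 + t = t * 2 + (1 - t) * 1 by ring.
by apply: le_trans h _; rewrite le_eqVlt; apply/orP; left; apply/eqP; ring.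
Qed.

Lemma ell_norm_not_embeds_smaller (R : realType) (p q : R) (p1 : 1 <= p)
  (q1 : 1 <= q) : q < p -> ~ lipschitz_embeds (ell_norm p1) (ell_norm q1).
Proof.
move=> qp [f [_ [A [B [A0 B0 fAB]]]]].
have q0 : 0 < q := lt_le_trans ltr01 q1.
have p0 : 0 < p := lt_le_trans ltr01 p1.
have ne : (spike p0 0 1 : ell_norm p1) != ell0 p0.
  apply/eqP => /(congr1 (fun x : ell p => x 0%N)) /= /eqP.
  by rewrite oner_eq0.
have [sigma s0 [flip fext]] := lipschitz_constant A0 ne fAB.
(* [2 * (2 `^ q - 1) * 3] bounds the defect of the image midpoints, whose
   relative error is [3 * eta], and [1] is the slack of [midpoints_cluster]. *)
pose K1 : R := 2 * (2 `^ q - 1) * 3 + 1.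
have K10 : 0 < K1.
  have : 1 <= 2 `^ q by rewrite (le_trans _ (ler_powR _ q1)) ?powRr1// ler1n.
  by rewrite /K1; lra.
have main (eta : R) : 0 < eta -> eta <= 3^-1 ->
    eta `^ (q / p) <= (4 * A * sigma) `^ q * K1 * eta.
  move=> eta0 eta3; have eta1 : 0 < 1 - eta by lra.
  have eta1' : 0 < 1 + eta by lra.
  have eta31 : 0 < 1 + 3 * eta by lra.
  have e3 : 0 <= 3 * eta <= 1 by lra.
  have eta2 : 1 + eta <= (1 + 3 * eta) * (1 - eta) by nra.
  have [x [y [xy hxy]]] := fext _ eta0.
  have [D DE] : {D | mdist x y = D} by eexists.
  have [E EE] : {E | mdist (f x) (f y) = E} by eexists.
  have Dp : D `^ p = ell_psum x y by rewrite -DE; exact: mdist_norm_powR.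
  have Eq : E `^ q = ell_psum (f x) (f y) by rewrite -EE; exact: mdist_norm_powR.
  rewrite DE EE in xy hxy.
  have E0 : 0 < E := lt_le_trans (mulr_gt0 eta1 (mulr_gt0 s0 xy)) hxy.
  have Dp0 : 0 < ell_psum x y by rewrite -Dp; exact: powR_gt0.
  have [z [zx zy zz]] := spread_midpoints p0 eta0 Dp0.
  pose K := (2^-1 * ((1 + 3 * eta) * E)) `^ q.
  have close w (v : ell_norm p1) :
      ell_psum (w : ell p) v <= (1 + eta) * (2^-1 `^ p * ell_psum x y) ->
      ell_psum (f w) (f v) <= K.
    move=> wv; rewrite -mdist_norm_powR ge0_ler_powR ?nnegrE ?mdist_ge0 ?(ltW q0)//.
      by rewrite !mulr_ge0// ?(ltW E0) ?(ltW eta31).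
    apply: le_trans (flip _ _) _.
    have wvD : mdist (w : ell_norm p1) v <= 2^-1 * ((1 + eta) * D).
      apply: (@le_trans _ _ (((1 + eta) * (2^-1 `^ p * ell_psum x y)) `^ p^-1)).
        rewrite ge0_ler_powR ?nnegrE ?invr_ge0 ?(ltW p0)//.
          exact: ell_psum_ge0.
        by rewrite (le_trans _ wv)// ell_psum_ge0.
      rewrite -Dp -powRM ?(ltW xy)// (@powRM _ (1 + eta)) ?powR_ge0 ?(ltW eta1')//.
      rewrite -powRrM mulfV ?gt_eqF// powRr1 ?mulr_ge0 ?(ltW xy)//.
      rewrite mulrCA ler_wpM2l// ler_wpM2r ?(ltW xy)//.
      by rewrite ler1_powR ?invf_le1// lerDl ltW.
    apply: (le_trans (ler_wpM2l (ltW s0) wvD)).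
    rewrite mulrCA ler_wpM2l// mulrCA.
    have : (1 + 3 * eta) * ((1 - eta) * (sigma * D)) <= (1 + 3 * eta) * E.
      by rewrite ler_wpM2l// ltW.
    apply: le_trans; rewrite [leRHS]mulrA ler_wpM2r ?mulr_ge0 ?(ltW s0) ?(ltW xy)//.
  have eE0 : 0 < eta * E `^ q by rewrite mulr_gt0// powR_gt0.
  have [n [m [nm hnm]]] := midpoints_cluster q1 eE0
    (fun n => close _ _ (zx n)) (fun n => close _ _ (zy n)).
  have up : ell_psum (f (z n)) (f (z m)) <= K1 * eta * (sigma * D) `^ q.
    apply: le_trans hnm _.
    rewrite /K -powRM ?mulr_ge0 ?(ltW E0) ?(ltW eta31)//.
    rewrite mulrA mulfV// mul1r powRM ?(ltW E0) ?(ltW eta31)//.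
    rewrite -Eq.
    have lin := ler_wpM2r (powR_ge0 E q) (powR_linear_bound q1 e3).
    have ED : E `^ q <= (sigma * D) `^ q.
      rewrite ge0_ler_powR ?nnegrE ?(ltW q0) ?(ltW E0) ?mulr_ge0 ?(ltW s0) ?(ltW xy)//.
      by rewrite -DE -EE; exact: flip.
    apply: le_trans (ler_wpM2l (ltW (mulr_gt0 K10 eta0)) ED).
    have -> : K1 * eta * E `^ q =
        2 * ((1 + (2 `^ q - 1) * (3 * eta)) * E `^ q - E `^ q) + eta * E `^ q.
      by rewrite /K1; ring.
    by rewrite lerD2r ler_wpM2l// lerD2r.
  have low : (A^-1 * (4^-1 * (eta `^ p^-1 * D))) `^ q <=
      ell_psum (f (z n)) (f (z m)).
    rewrite -mdist_norm_powR.
    rewrite ge0_ler_powR ?nnegrE ?mdist_ge0 ?(ltW q0)//.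
      by rewrite !mulr_ge0 ?invr_ge0 ?powR_ge0 ?(ltW xy) ?(ltW A0).
    have /andP[h _] := fAB (z n) (z m); apply: le_trans h.
    rewrite ler_wpM2l ?invr_ge0 ?(ltW A0)//.
    have zD : 4^-1 * (eta `^ p^-1 * D) =
        (4^-1 `^ p * (eta * ell_psum x y)) `^ p^-1.
      rewrite -Dp powRM ?mulr_ge0 ?powR_ge0 ?(ltW eta0)//.
      rewrite -powRrM mulfV ?gt_eqF// powRr1//; congr (_ * _).
      rewrite powRM ?powR_ge0 ?(ltW eta0)//.
      by rewrite -powRrM mulfV ?gt_eqF// powRr1// ltW.
    rewrite zD; rewrite ge0_ler_powR ?nnegrE ?invr_ge0 ?(ltW p0)//.
    - by rewrite !mulr_ge0 ?powR_ge0 ?(ltW eta0) ?(ltW Dp0).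
    - exact: ell_psum_ge0.
    - exact: zz.
  have := le_trans low up.
  have -> : A^-1 * (4^-1 * (eta `^ p^-1 * D)) =
      (eta `^ p^-1) * ((4 * A * sigma)^-1 * (sigma * D)).
    by field; rewrite !gt_eqF.
  have S0 : 0 < 4 * A * sigma by rewrite !mulr_gt0.
  rewrite powRM ?powR_ge0 ?mulr_ge0 ?invr_ge0 ?(ltW S0) ?(ltW s0) ?(ltW xy)//.
  rewrite -powRrM [_ * q]mulrC (@powRM _ (4 * A * sigma)^-1)
    ?mulr_ge0 ?invr_ge0 ?(ltW S0) ?(ltW s0) ?(ltW xy)//.
  rewrite [leLHS]mulrA ler_pM2r ?powR_gt0 ?mulr_gt0//.
  have -> : (4 * A * sigma)^-1 `^ q = ((4 * A * sigma) `^ q)^-1.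
    by rewrite -powRN -[(_)^-1]powR_inv1 ?(ltW S0)// -powRrM mulN1r.
  by rewrite ler_pdivrMr ?powR_gt0// [X in _ <= X -> _]mulrC mulrA.
(* With [eta = 1 / k] the bound reads [k^(1 - q/p) <= C]. *)
apply: (@powR_superlinear _ (2 - q / p) ((4 * A * sigma) `^ q * K1) 3).
  by rewrite ltrBrDr -ltrBrDl (_ : 2 - 1 = 1) ?ltr_pdivrMr ?mul1r//; lra.
move=> k k3.
have k0 : 0 < k%:R :> R by rewrite ltr0n (leq_trans _ k3).
have := main k%:R^-1; rewrite invr_gt0 k0 lef_pV2 ?posrE// ler_nat k3.
move=> /(_ isT isT); rewrite -powR_inv1 ?ler0n// -powRrM mulN1r powR_inv1 ?ler0n//.
move=> h; have -> : k%:R `^ (2 - q / p) = k%:R `^ (- (q / p)) * k%:R ^+ 2.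
  by rewrite addrC powRD ?(gt_eqF k0) ?implybT// powR_mulrn.
have -> : (4 * A * sigma) `^ q * K1 * k%:R =
    (4 * A * sigma) `^ q * K1 * k%:R^-1 * k%:R ^+ 2.
  by field; rewrite gt_eqF.
by rewrite ler_wpM2r// exprn_ge0// ltW.
Qed.

(** * Sums over countable families *)

Section ExtendedSums.
Variable R : realType.

Lemma esum_nat_le (a : nat -> R) (c : R) : (forall n, 0 <= a n) ->
  (forall N, \sum_(0 <= n < N) a n <= c) ->
  (\esum_(n in [set: nat]) (a n)%:E <= c%:E)%E.
Proof.
move=> a0 ac; rewrite -nneseries_esumT => [|n]; last by rewrite lee_fin.
apply: lime_le; first by apply: is_cvg_nneseries => n _ _; rewrite lee_fin.
by apply: nearW => N; rewrite sumEFin lee_fin.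
Qed.

Lemma le_esum_nat (a : nat -> R) (c : R) N : (forall n, 0 <= a n) ->
  (\esum_(n in [set: nat]) (a n)%:E <= c%:E)%E -> \sum_(0 <= n < N) a n <= c.
Proof.
move=> a0; rewrite -nneseries_esumT => [h|n]; last by rewrite lee_fin.
rewrite -lee_fin -sumEFin; apply: le_trans h.
by apply: nneseries_lim_ge => n _; rewrite lee_fin.
Qed.

Lemma esum_bool (a : bool -> \bar R) : (forall b, 0 <= a b)%E ->
  (\esum_(b in [set: bool]) a b = a true + a false)%E.
Proof.
move=> a0; rewrite (esumID [set true])// !setTI esum_set1//.
rewrite (_ : ~` [set true] = [set false]) ?esum_set1//.
by apply/seteqP; split=> -[] //= h; exfalso; apply: h.
Qed.

Lemma esum_int (a : int -> \bar R) : (forall i, 0 <= a i)%E ->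
  (\esum_(i in [set: int]) a i =
   \esum_(n in [set: nat]) a (Posz n) + \esum_(n in [set: nat]) a (Negz n))%E.
Proof.
move=> a0; rewrite (esumID (range Posz))// !setTI.
rewrite (_ : ~` range Posz = range Negz); last first.
  apply/seteqP; split=> [[n|n]|_ [n _ <-] [m _ //]] //= h.
  - by exfalso; apply: h; exists n.
  - by exists n.
by congr (_ + _)%E; apply: esum_image => m n _ _ [].
Qed.

Lemma geometric_sum_le (c rho : R) N : 0 <= c -> 0 <= rho < 1 ->
  \sum_(0 <= n < N) c * rho ^+ n <= c / (1 - rho).
Proof.
move=> c0 /andP[r0 r1]; have r1' : 0 < 1 - rho by rewrite subr_gt0.
rewrite -mulr_sumr ler_wpM2l// -[leRHS]mul1r ler_pdivlMr//.
rewrite mulrC big_mkord -opprB mulNr -subrX1 opprB.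
by rewrite gerBl exprn_ge0.
Qed.

Lemma esum_int_geometric (a : int -> R) (j0 : int) (c rho : R) :
  0 <= c -> 0 <= rho < 1 -> (forall j, 0 <= a j) ->
  (forall n, a (j0 + Posz n) <= c * rho ^+ n) ->
  (forall n, a (j0 + Negz n) <= c * rho ^+ n) ->
  (\esum_(j in [set: int]) (a j)%:E <= (2 * (c / (1 - rho)))%:E)%E.
Proof.
move=> c0 rho01 a0 aP aN.
rewrite (@reindex_esum _ _ _ [set: int] _ (fun i => j0 + i)); last first.
  split=> [i _ //|i j _ _|j _]; first exact: addrI.
  by exists (j - j0) => //; rewrite subrKC.
rewrite esum_int => [|i]; last by rewrite lee_fin.
rewrite mulr2n mulrDl mul1r EFinD; apply: leeD.
  apply: esum_nat_le => // N; apply: le_trans (geometric_sum_le N c0 rho01).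
  by apply: ler_sum => n _; exact: aP.
apply: esum_nat_le => // N; apply: le_trans (geometric_sum_le N c0 rho01).
by apply: ler_sum => n _; exact: aN.
Qed.

End ExtendedSums.

(** * Embedding the snowflake of the line *)

Section Waves.
Variable R : realType.
Implicit Types s t : R.

(** The cosine and, for [b = true], the sine: one definition serves both because
they differ by a quarter period. *)
Definition wave (b : bool) t := cos (t - b%:R * (pi / 2)).

Lemma wave_bounded b s t : `|wave b s - wave b t| <= 2.
Proof.
apply: le_trans (ler_normB _ _) _.
have := cos_max (s - b%:R * (pi / 2)); have := cos_max (t - b%:R * (pi / 2)).
by rewrite /wave; lra.
Qed.

Lemma wave_lipschitz b s t : `|wave b s - wave b t| <= `|s - t|.
Proof.
wlog st : s t / t <= s.
  move=> h; have [/h//|/ltW /h] := leP t s.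
  by rewrite distrC [leRHS]distrC.
have st' : t - b%:R * (pi / 2) <= s - b%:R * (pi / 2) by rewrite lerD2r.
have cont : {within `[t - b%:R * (pi / 2), s - b%:R * (pi / 2)], continuous cos}.
  by apply: continuous_subspaceT => x; exact: continuous_cos.
have [c _] := MVT_segment st' (fun x _ => is_derive_cos x) cont.
rewrite -/(wave b s) -/(wave b t) => ->.
rewrite opprB addrA subrK normrM normrN.
by rewrite ler_piMl// sin_max.
Qed.

(** The two waves parametrize the unit circle, on which the squared chord is
[2 * (1 - cos (s - t))]. *)
Lemma wave_separates : exists2 k : R, 0 < k &
  forall s t, 2^-1 <= `|s - t| <= 1 -> exists b, k <= `|wave b s - wave b t|.
Proof.
have c1 : cos 2^-1 < 1 :> R.
  have := @ltr_cos R 0 2^-1; rewrite cos0 !in_itv/= lexx pi_ge0/=.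
  have := @pi_ge2 R => pi2.
  by rewrite invr_ge0 ler0n (le_trans _ pi2) ?invr_gt0 ?ltr0n => [->//|]; lra.
exists (1 - cos 2^-1); first by rewrite subr_gt0.
move=> s t /andP[h1 h2]; set k := 1 - _.
have ch : cos (s - t) <= cos 2^-1.
  rewrite -cos_norm leNgt ltr_cos ?in_itv/= ?normr_ge0 ?invr_ge0 ?ler0n//=.
  - by rewrite -leNgt.
  - by have := @pi_ge2 R; lra.
  - by have := @pi_ge2 R; lra.
have [h|h] := leP k `|wave true s - wave true t|; first by exists true.
exists false; rewrite leNgt; apply/negP => h'.
have k1 : k <= 1.
  have := cos_ge0_pihalf (x := (2^-1 : R)); have := @pihalf_ge1 R.
  by rewrite /k; lra.
have k0 : 0 < k by rewrite subr_gt0.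
have sq (v : R) : `|v| < k -> v ^+ 2 < k.
  rewrite -real_normK ?num_real// => vk; apply: lt_le_trans (_ : k ^+ 2 <= k).
    by rewrite ltr_pXn2r// nnegrE ltW.
  by rewrite expr2 ger_pMr.
have : (cos s - cos t) ^+ 2 + (sin s - sin t) ^+ 2 = 2 * (1 - cos (s - t)).
  rewrite cosB; have := cos2Dsin2 s; have := cos2Dsin2 t; lra.
have := sq _ h; have := sq _ h'.
rewrite /wave !mul0r !subr0 !mul1r !cosBpihalf /k; lra.
Qed.

End Waves.

Section Chirps.
Variables (R : realType) (p q : R).
Hypotheses (p0 : 0 < p) (pq : p < q).
Let q0 : 0 < q := lt_trans p0 pq.
Implicit Types (s t L x : R) (b : bool).

Definition chirp L b t := L `^ (p / q) * wave b (t / L).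

Lemma chirp_diff L b s t : `|chirp L b s - chirp L b t| `^ q =
  L `^ p * `|wave b (s / L) - wave b (t / L)| `^ q.
Proof.
rewrite /chirp -mulrBr normrM (ger0_norm (powR_ge0 _ _)) powRM ?powR_ge0//.
by rewrite -powRrM divfK// gt_eqF.
Qed.

(** At scales below [|s - t|], only the boundedness of the wave is used. *)
Lemma chirp_fine L b s t x : 0 < L -> 0 <= x -> L <= `|s - t| * x ->
  `|chirp L b s - chirp L b t| `^ q <= 2 `^ q * `|s - t| `^ p * x `^ p.
Proof.
move=> L0 x0 Lx; rewrite chirp_diff mulrC -mulrA -powRM//.
apply: ler_pM; rewrite ?powR_ge0// ge0_ler_powR ?nnegrE ?(ltW q0) ?(ltW p0)//.
- exact: wave_bounded.
- exact: ltW.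
- exact: mulr_ge0.
Qed.

(** At scales above [|s - t|], the Lipschitz bound of the wave gains the factor
[(|s - t| / L)^(q - p)]. *)
Lemma chirp_coarse L b s t x : 0 < L -> 0 <= x -> `|s - t| <= 2 * (x * L) ->
  `|chirp L b s - chirp L b t| `^ q <= 2 `^ q * `|s - t| `^ p * x `^ (q - p).
Proof.
move=> L0 x0 dx; have [->|st] := eqVneq s t.
  by rewrite subrr normr0 powR0 ?gt_eqF// !mulr_ge0 ?powR_ge0.
have d0 : 0 < `|s - t| by rewrite normr_gt0 subr_eq0.
have dL0 : 0 < `|s - t| / L by rewrite divr_gt0.
have qp0 : 0 < q - p by rewrite subr_gt0.
rewrite chirp_diff; apply: (@le_trans _ _ (L `^ p * (`|s - t| / L) `^ q)).
  rewrite ler_wpM2l ?powR_ge0// ge0_ler_powR ?nnegrE ?(ltW q0) ?(ltW dL0)//.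
  apply: le_trans (wave_lipschitz _ _ _) _.
  by rewrite -mulrBl normrM (@ger0_norm _ L^-1) ?invr_ge0 ?(ltW L0).
have -> : (`|s - t| / L) `^ q = (`|s - t| / L) `^ p * (`|s - t| / L) `^ (q - p).
  by rewrite -powRD ?subrKC// (gt_eqF dL0) implybT.
rewrite mulrA -powRM ?(ltW dL0) ?(ltW L0)//.
rewrite mulrCA mulfV ?gt_eqF// mulr1 mulrAC [leRHS]mulrC ler_wpM2l ?powR_ge0//.
apply: (@le_trans _ _ ((2 * x) `^ (q - p))).
  rewrite ge0_ler_powR ?nnegrE ?(ltW qp0) ?(ltW dL0) ?mulr_ge0//.
  by rewrite ler_pdivrMr// -mulrA.
rewrite powRM// ler_wpM2r ?powR_ge0// ler_powR ?ler1n//.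
by rewrite gerBl ltW.
Qed.

End Chirps.

Section Dyadic.
Variable R : realType.

Definition dyadic (j : int) : R := 2 `^ j%:~R.

Lemma dyadic_gt0 j : 0 < dyadic j. Proof. exact: powR_gt0. Qed.

Lemma dyadicD i j : dyadic (i + j) = dyadic i * dyadic j.
Proof. by rewrite /dyadic intrD powRD ?pnatr_eq0 ?implybT. Qed.

Lemma dyadic1 : dyadic 1 = 2. Proof. by rewrite /dyadic powRr1. Qed.

Lemma dyadicP (d : R) : 0 < d -> exists j, dyadic j <= d < dyadic (j + 1).
Proof.
move=> d0; have l2 : 0 < ln 2 :> R by rewrite ln_gt0// ltr1n.
exists (Num.floor (ln d / ln 2)).
have E j : dyadic j = expR (j%:~R * ln 2) by rewrite /dyadic /powR pnatr_eq0.
rewrite !E -[d in _ <= d < _]lnK ?posrE//.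
rewrite ler_expR ltr_expR -ler_pdivlMr// -ltr_pdivrMr//.
by rewrite floor_le floorD1_gt.
Qed.

Lemma dyadic_Posz n : dyadic (Posz n) = (2 ^+ n).
Proof. by rewrite /dyadic -powR_mulrn. Qed.

Lemma dyadic_Negz n : dyadic (Negz n) = 2^-1 ^+ n.+1.
Proof. by rewrite /dyadic NegzE mulrNz powRN powR_mulrn// exprVn. Qed.

End Dyadic.

Section ChirpFamily.
Variables (R : realType) (p q : R).
Hypotheses (p0 : 0 < p) (pq : p < q).
Let q0 : 0 < q := lt_trans p0 pq.

Definition dyadic_chirp (c : bool * int) : R -> R :=
  chirp p q (dyadic R c.2) c.1.

(** Only the scale just above [|s - t|] is used. *)
Lemma dyadic_chirp_lower : exists2 k : R, 0 < k &
  forall s t, exists c,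
    k * `|s - t| `^ p <= `|dyadic_chirp c s - dyadic_chirp c t| `^ q.
Proof.
have [k k0 hk] := wave_separates R.
exists (k `^ q); first exact: powR_gt0.
move=> s t; have [->|st] := eqVneq s t.
  by exists (true, 0); rewrite subrr normr0 powR0 ?gt_eqF// mulr0 powR_ge0.
have d0 : 0 < `|s - t| by rewrite normr_gt0 subr_eq0.
have [j /andP[jd dj]] := dyadicP d0.
have [L [LE L0]] : exists L, dyadic R (j + 1) = L /\ 0 < L.
  by eexists; split; [reflexivity|exact: dyadic_gt0].
rewrite LE in dj.
have jL : L <= 2 * `|s - t|.
  by rewrite -LE dyadicD dyadic1 mulrC ler_pM2l.
have [|b kb] := hk (s / L) (t / L).
  rewrite -mulrBl normrM (@ger0_norm _ L^-1) ?invr_ge0 ?(ltW L0)//.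
  by rewrite ler_pdivlMr// ler_pdivrMr// mul1r (ltW dj) andbT ler_pdivrMl.
exists (b, j + 1); rewrite /dyadic_chirp /= LE chirp_diff//.
rewrite mulrC; apply: ler_pM; rewrite ?powR_ge0//.
  by rewrite ge0_ler_powR ?nnegrE ?(ltW p0) ?(ltW dj) ?(ltW L0).
by rewrite ge0_ler_powR ?nnegrE ?(ltW q0) ?(ltW k0).
Qed.

Lemma powR_expn (a e : R) n : 0 <= a -> (a ^+ n) `^ e = (a `^ e) ^+ n.
Proof.
by move=> a0; rewrite -!powR_mulrn ?powR_ge0// -!powRrM mulrC.
Qed.

(** Counted from the scale of [|s - t|], the contributions decrease
geometrically in both directions: with ratio [2^(p - q)] upwards and [2^(- p)]
downwards. *)
Lemma dyadic_chirp_upper : exists2 C : R, 0 < C & forall s t,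
  (\esum_(c in [set: bool * int])
     (`|dyadic_chirp c s - dyadic_chirp c t| `^ q)%:E <=
   (C * `|s - t| `^ p)%:E)%E.
Proof.
have qp0 : 0 < q - p by rewrite subr_gt0.
pose rho : R := Num.max (2^-1 `^ (q - p)) (2^-1 `^ p).
have half_lt1 (e : R) : 0 < e -> 2^-1 `^ e < 1 :> R.
  move=> e0; apply: (@lt_le_trans _ _ (1 `^ e)); last by rewrite powR1.
  by rewrite gt0_ltr_powR ?nnegrE//; lra.
have rho0 : 0 <= rho by rewrite le_max powR_ge0.
have rho1 : rho < 1 by rewrite gt_max !half_lt1.
have rho01 : 0 <= rho < 1 by rewrite rho0.
have r1 : 0 < 1 - rho by rewrite subr_gt0.
have rhoP n : (2^-1 ^+ n) `^ (q - p) <= rho ^+ n.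
  by rewrite powR_expn// lerXn2r ?nnegrE ?powR_ge0// le_max lexx.
have rhoN n : (2^-1 ^+ n) `^ p <= rho ^+ n.
  by rewrite powR_expn// lerXn2r ?nnegrE ?powR_ge0// le_max lexx orbT.
pose K : R := 2 * (2 `^ q / (1 - rho)).
have K0 : 0 < K by rewrite !mulr_gt0 ?powR_gt0 ?invr_gt0.
exists (K + K); first exact: addr_gt0.
move=> s t; set d := `|s - t|.
pose F b j : \bar R :=
  (`|dyadic_chirp (b, j) s - dyadic_chirp (b, j) t| `^ q)%:E.
have F0 b j : (0 <= F b j)%E by rewrite lee_fin powR_ge0.
suff FK b : (\esum_(j in [set: int]) F b j <= (K * d `^ p)%:E)%E.
  have := @esum_esum R bool int [set: bool] (fun=> [set: int]) F
    (fun b j _ _ => F0 b j).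
  have -> : [set: bool] `*`` (fun=> [set: int]) = [set: bool * int].
    by apply/seteqP; split.
  rewrite esum_bool => [|b]; last by apply: esum_ge0.
  rewrite (eq_esum (b := fun c => F c.1 c.2)) => [<-|[]//].
  by rewrite mulrDl EFinD leeD.
have [st|st] := eqVneq s t.
  rewrite esum1 => [|j _].
    by rewrite lee_fin (mulr_ge0 (ltW K0)) ?powR_ge0.
  by rewrite /F st subrr normr0 powR0 ?gt_eqF.
have d0 : 0 < d by rewrite normr_gt0 subr_eq0.
have [j /andP[jd dj]] := dyadicP d0.
have -> : K * d `^ p = 2 * (2 `^ q * d `^ p / (1 - rho)).
  by rewrite /K -mulrA [_ / _ * _]mulrAC.
apply: (@esum_int_geometric _ _ j) => //.
- by rewrite mulr_ge0 ?powR_ge0.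
- move=> n; have x0 : 0 <= 2^-1 ^+ n :> R by rewrite exprn_ge0.
  apply: le_trans (chirp_coarse p0 pq b (dyadic_gt0 R (j + n)) x0 _) _.
    rewrite (_ : 2^-1 ^+ n * dyadic R (j + n) = dyadic R j).
      by rewrite (le_trans (ltW dj))// dyadicD dyadic1 mulrC.
    by rewrite dyadicD dyadic_Posz mulrCA -exprMn mulVf// expr1n mulr1.
  by rewrite ler_wpM2l ?mulr_ge0 ?powR_ge0.
- move=> n; have x0 : 0 <= 2^-1 ^+ n :> R by rewrite exprn_ge0.
  apply: le_trans (chirp_fine p0 pq b (dyadic_gt0 R (j + Negz n)) x0 _) _.
    rewrite dyadicD dyadic_Negz ler_pM ?(ltW (dyadic_gt0 _ _)) ?exprn_ge0//.
    by rewrite exprS ler_piMl ?exprn_ge0//; lra.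
  by rewrite ler_wpM2l ?mulr_ge0 ?powR_ge0.
Qed.

End ChirpFamily.

(** * Coordinatewise embeddings *)

Section CoordinatewiseEmbedding.
Variables (R : realType) (p q : R) (p01 : 0 < p <= 1) (q01 : 0 < q <= 1).
Variables (C : countType) (phi : C -> R -> R) (k K : R).
Hypotheses (k0 : 0 < k) (K0 : 0 < K).
Hypothesis phi_lower : forall s t, exists c,
  k * `|s - t| `^ p <= `|phi c s - phi c t| `^ q.
Hypothesis phi_upper : forall s t,
  (\esum_(c in [set: C]) (`|phi c s - phi c t| `^ q)%:E <=
   (K * `|s - t| `^ p)%:E)%E.
Let p0 : 0 < p. Proof. by case/andP: p01. Qed.
Let q0 : 0 < q. Proof. by case/andP: q01. Qed.

(* Subtracting [phi c 0] makes the image of 0 vanish, hence all images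
   summable. *)
Let spread (x : nat -> R) (m : nat) : R :=
  if @pickle_inv (nat * C)%type m is Some (n, c)
  then phi c (x n) - phi c 0 else 0.

Let spread_pickle x n c : spread x (pickle (n, c)) = phi c (x n) - phi c 0.
Proof. by rewrite /spread pickleK_inv. Qed.

Let spread_bound (x y : ell p) N :
  \sum_(0 <= m < N) `|spread x m - spread y m| `^ q <= K * ell_psum x y.
Proof.
apply: le_esum_nat => [m|]; first exact: powR_ge0.
pose G m := (`|spread x m - spread y m| `^ q)%:E.
pose F n c := (`|phi c (x n) - phi c (y n)| `^ q)%:E.
have F0 n c : (0 <= F n c)%E by rewrite lee_fin powR_ge0.
(* Integers that encode no pair contribute 0, so that the sum is indexed by
   the pairs [(n, c)]. *)
have -> : (\esum_(m in [set: nat]) G m =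
    \esum_(m in range (@pickle (nat * C)%type)) G m)%E.
  rewrite [RHS]esum_mkcond; apply: eq_esum => m _.
  case: ifPn => // /negP mP; rewrite /G /spread.
  case E : (@pickle_inv _ m) => [nc|].
    exfalso; apply: mP; rewrite inE; exists nc => //.
    by have := @pickle_invK (nat * C)%type m; rewrite E.
  by rewrite subrr normr0 powR0 ?gt_eqF.
rewrite esum_image => [|a b _ _]; last exact: (pcan_inj pickleK_inv).
have GF nc : G (pickle nc) = F nc.1 nc.2.
  case: nc => n c; rewrite /G !spread_pickle /F /=.
  by rewrite opprB addrA subrK.
under eq_esum do rewrite GF.
have := @esum_esum R nat C [set: nat] (fun=> [set: C]) F (fun n c _ _ => F0 n c).
have -> : [set: nat] `*`` (fun=> [set: C]) = [set: nat * C].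
  by apply/seteqP; split.
move=> <-; apply: (@le_trans _ _
  (\esum_(n in [set: nat]) (K * `|x n - y n| `^ p)%:E)%E).
  by apply: le_esum => n _; exact: phi_upper.
apply: esum_nat_le => [n|M]; first by rewrite mulr_ge0 ?powR_ge0 ?(ltW K0).
by rewrite -mulr_sumr ler_wpM2l ?(ltW K0)// psum_partial.
Qed.

Let spread_summable (x : ell p) :
  cvgn (series (fun m => `|spread x m| `^ q)).
Proof.
apply: (@summable_bounded _ _ _ (K * ell_psum x (ell0 p0))) => N.
apply: le_trans (spread_bound x (ell0 p0) N); apply: ler_sum => m _.
have -> : spread (ell0 p0) m = 0.
  by rewrite /spread; case: pickle_inv => // -[n c]; rewrite subrr.
by rewrite subr0.
Qed.

Let embed (x : ell p) : ell q := Ell (@spread_summable x).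

Let embed_lower (x y : ell p) :
  k * ell_psum x y <= ell_psum (embed x) (embed y).
Proof.
rewrite mulrC -ler_pdivlMr//; apply: psum_le => // N.
rewrite ler_pdivlMr// mulrC mulr_sumr.
have [c hc] := choice (fun n => phi_lower (x n) (y n)).
have us : uniq [seq pickle (n, c n) | n <- index_iota 0 N].
  rewrite map_inj_uniq ?iota_uniq// => n m /(pcan_inj pickleK_inv).
  by case.
apply: le_trans (psum_seq q0 _ _ us); rewrite big_map; apply: ler_sum => n _.
by rewrite /= !spread_pickle opprB addrA subrK.
Qed.

Lemma coordinatewise_embeds : lipschitz_embeds (ell_dp p01) (ell_dp q01).
Proof.
exists embed; split.
  move=> x y xy; apply: (ell_psum_eq0 p0); apply/eqP.
  rewrite eq_le ell_psum_ge0// andbT -(pmulr_rle0 _ k0).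
  by apply: le_trans (embed_lower x y) _; rewrite xy ell_psumxx.
exists k^-1, K; split; rewrite ?invr_gt0// => x y; rewrite invrK.
apply/andP; split; first exact: embed_lower.
by apply: psum_le => // N; exact: spread_bound.
Qed.

End CoordinatewiseEmbedding.

Theorem proposition4p4 (R : realType) :
  [/\ forall (p q : R) (p1 : 1 <= p) (q1 : 1 <= q), p != q ->
        ~ lipschitz_embeds (ell_norm p1) (ell_norm q1),
      forall (p q : R) (p01 : 0 < p <= 1) (q1 : 1 <= q), p < 1 -> 1 < q ->
        ~ lipschitz_embeds (ell_norm q1) (ell_dp p01) /\
        ~ lipschitz_embeds (ell_dp p01) (ell_norm q1)
    & forall (p q : R) (p01 : 0 < p <= 1) (q01 : 0 < q <= 1), p < q ->
        lipschitz_embeds (ell_dp p01) (ell_dp q01) /\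
        ~ lipschitz_embeds (ell_dp q01) (ell_dp p01)].
Proof.
split=> [p q p1 q1|p q p01 q1 p1 q1'|p q p01 q01 pq].
- rewrite neq_lt => /orP[pq|qp].
  + exact: ell_norm_not_embeds_larger (lt_le_trans ltr01 p1) p1 q q1 pq.
  + exact: ell_norm_not_embeds_smaller qp.
- split; first exact: ell_norm_not_embeds_dp.
  by have /andP[p0 _] := p01; exact: ell_dp_not_embeds_norm p0 p01 q q1 q1'.
- split; last exact: ell_dp_not_embeds_smaller.
  have /andP[p0 _] := p01.
  have [k k0 lower] := dyadic_chirp_lower p0 pq.
  have [K K0 upper] := dyadic_chirp_upper p0 pq.
  exact: coordinatewise_embeds k0 K0 lower upper.
Qed.
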